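(* There is a universal constant $C>0$ such that for all $d\ge1$, $\kappa\ge1$ and $\varepsilon\in(0,1/2)$ the following holds. There is a (randomized, adaptive) algorithm which, given access to an unknown positive definite matrix $\Lambda=\Sigma^{-1}\in\mathbb{R}^{d\times d}$ with all eigenvalues between $1$ and $\kappa$ through matrix-vector queries, uses at most $C\min\bigl(\sqrt\kappa\,\log\frac d\varepsilon,\ d\bigr)$ adaptive matrix-vector queries to $\Lambda$ and produces a sample from a distribution $\hat\pi$ with $\mathrm{KL}\bigl(\hat\pi\,\|\,\mathcal{N}(0,\Sigma)\bigr)\le\varepsilon^2$.
   Context: A matrix-vector query at $x\in\mathbb{R}^d$ returns $\Lambda x$. The algorithm may know $d,\kappa,\varepsilon$. $\mathrm{KL}$ denotes the Kullback–Leibler divergence. Only the number of queries is counted. *)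

(* Defs.v *)
From HB Require Import structures.
From mathcomp Require Import all_boot all_order all_algebra.
From mathcomp Require Import all_classical all_reals all_analysis.
From mathcomp Require Import measurable_realfun.

Set Implicit Arguments.
Unset Strict Implicit.
Unset Printing Implicit Defensive.

Import Order.TTheory GRing.Theory Num.Theory.
Import numFieldNormedType.Exports.

Local Open Scope classical_set_scope.
Local Open Scope ring_scope.

(* Vectors of R^d are represented by [d.-tuple R], which the library equips
   with the product (= Borel) sigma-algebra. *)

Section vectors.
Context {R : realType} {d : nat}.
Implicit Types (M : 'M[R]_d) (x : d.-tuple R).

Definition colv x : 'cV[R]_d := \col_i tnth x i.

Definition matvec M x : d.-tuple R := [tuple (M *m colv x) i 0 | i < d].

Definition qform M x : R := ((colv x)^T *m M *m colv x) 0 0.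

Definition posdef M :=
  M^T = M /\ forall v : 'cV[R]_d, v != 0 -> 0 < (v^T *m M *m v) 0 0.

Lemma matvecE M x i : tnth (matvec M x) i = \sum_j M i j * tnth x j.
Proof. by rewrite tnth_mktuple mxE; apply: eq_bigr => j _; rewrite mxE. Qed.

Lemma qformE M x : qform M x = \sum_i \sum_j tnth x j * M j i * tnth x i.
Proof.
rewrite /qform mxE; apply: eq_bigr => i _; rewrite !mxE mulr_suml.
by apply: eq_bigr => j _; rewrite !mxE.
Qed.

Lemma measurable_matvec M : measurable_fun setT (matvec M).
Proof.
apply/measurable_fun_tnthP => i.
rewrite (_ : _ \o _ = fun x => \sum_j M i j * tnth x j); last first.
  by apply/funext => x /=; rewrite matvecE.
by apply: measurable_sum => j; apply: measurable_funM => //;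
  exact: measurable_tnth.
Qed.

Lemma measurable_qform M : measurable_fun setT (qform M).
Proof.
rewrite (_ : qform M = fun x => \sum_i \sum_j tnth x j * M j i * tnth x i).
  apply: measurable_sum => i; apply: measurable_sum => j.
  apply: measurable_funM; last exact: measurable_tnth.
  by apply: measurable_funM => //; exact: measurable_tnth.
by apply/funext => x; rewrite qformE.
Qed.

End vectors.

Lemma sigma_finite_prod d1 d2 (T1 : measurableType d1) (T2 : measurableType d2)
    (R : realType) (m1 : {sigma_finite_measure set T1 -> \bar R})
    (m2 : {sigma_finite_measure set T2 -> \bar R}) :
  sigma_finite setT (m1 \x m2)%E.
Proof.
have /sigma_finiteP[F [TF ndF Foo]] := sigma_finiteT m1.
have /sigma_finiteP[G [TG ndG Goo]] := sigma_finiteT m2.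
exists (fun n => F n `*` G n).
  rewrite -setXTT TF TG predeqE => -[x y]; split.
    move=> [/= [n _ Fnx] [k _ Gky]]; exists (maxn n k) => //; split.
    - by move: x Fnx; exact/subsetPset/ndF/leq_maxl.
    - by move: y Gky; exact/subsetPset/ndG/leq_maxr.
  by move=> [n _ []/= ? ?]; split; exists n.
move=> k; have [? ?] := Foo k; have [? ?] := Goo k.
split; first exact: measurableX.
by rewrite product_measure1E// lte_mul_pinfty// ge0_fin_numE.
Qed.

(* [lebn n] is the n-dimensional Lebesgue measure, obtained by iterating the
   library's binary product measure. *)

Section lebesgue.
Context {R : realType}.

Definition consv n (p : R * n.-tuple R) : n.+1.-tuple R :=
  [tuple of p.1 :: p.2].

Fixpoint lebn n : set (n.-tuple R) -> \bar R :=
  if n is m.+1 then pushforward (lebesgue_measure \x @lebn m)%E (@consv m)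
  else \d_[tuple].

Arguments lebn : clear implicits.

Lemma measurable_consv n : measurable_fun setT (@consv n).
Proof. exact: measurable_cons. Qed.


Lemma lebn_sigma_finite_measure n :
  exists m : {sigma_finite_measure set (n.-tuple R) -> \bar R},
    lebn n = m :> (set _ -> _).
Proof.
elim: n => [|n [m mE]]; first by exists (\d_[tuple]).
pose p0 : {measure set _ -> \bar R} :=
  pushforward (lebesgue_measure \x m)%E (@consv n).
pose p := p0 (@measurable_consv n).
have p_sf : sigma_finite setT p.
  have [F FT FP] := sigma_finite_prod lebesgue_measure m.
  pose g (t : n.+1.-tuple R) : measurableTypeR R * n.-tuple R :=
    (thead t, [tuple of behead t]).
  have mg : measurable_fun setT g.
    apply: measurable_fun_pair; first exact: measurable_tnth.
    exact: measurable_behead.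
  have gK x : g (consv x) = x.
    by case: x => a t; rewrite /g /=; congr pair; exact/val_inj.
  exists (fun i => g @^-1` F i).
    by rewrite -preimage_bigcup -FT preimage_setT.
  move=> i; have [mF Fi] := FP i; split.
    by rewrite -[X in measurable X]setTI; exact: mg.
  rewrite /p /= /pushforward (_ : _ @^-1` _ = F i)//.
  by apply/seteqP; split=> x /=; rewrite gK.
pose s : {sigma_finite_measure set _ -> \bar R} :=
  HB.pack (p : set _ -> _) (Measure.on p) (Measure_isSigmaFinite.Build _ _ _ _ p_sf).
by exists s; rewrite /= mE.
Qed.

Section lebn_instances.
Variable n : nat.

Let lebn0 : lebn n set0 = 0%E.
Proof. by have [m ->] := lebn_sigma_finite_measure n; exact: measure0. Qed.

Let lebn_ge0 A : (0 <= lebn n A)%E.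
Proof. by have [m ->] := lebn_sigma_finite_measure n; exact: measure_ge0. Qed.

Let lebn_semi_sigma_additive : semi_sigma_additive (lebn n).
Proof.
by have [m ->] := lebn_sigma_finite_measure n;
  exact: measure_semi_sigma_additive.
Qed.

HB.instance Definition _ := isMeasure.Build _ _ _ (lebn n)
  lebn0 lebn_ge0 lebn_semi_sigma_additive.

Let lebn_sigma_finite : sigma_finite setT (lebn n).
Proof.
by have [m ->] := lebn_sigma_finite_measure n; exact: sigma_finiteT.
Qed.

HB.instance Definition _ := Measure_isSigmaFinite.Build _ _ _ (lebn n)
  lebn_sigma_finite.

End lebn_instances.

End lebesgue.
Arguments lebn {R} n _.

Section gaussian.
Context {R : realType} {d : nat} (S : 'M[R]_d).

Definition gauss_pdf (x : d.-tuple R) : R :=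
  (Num.sqrt ((2 * pi) ^+ d * \det S))^-1 * expR (- (qform (invmx S) x / 2)).

(* The centred Gaussian law N(0, S); the definition is only meaningful for
   positive definite S. It is equipped with a sigma-finite measure structure,
   which makes sense for every S. *)
Definition gauss (A : set (d.-tuple R)) : \bar R :=
  (\int[lebn d]_(x in A) (gauss_pdf x)%:E)%E.

Lemma gauss_pdf_ge0 x : 0 <= gauss_pdf x.
Proof. by rewrite mulr_ge0// ?expR_ge0// invr_ge0 sqrtr_ge0. Qed.

Lemma measurable_gauss_pdf : measurable_fun setT gauss_pdf.
Proof.
apply: measurable_funM => //; apply: measurableT_comp => //.
apply: measurable_funN.
apply: measurable_funM => //; exact: measurable_qform.
Qed.

Let gauss0 : gauss set0 = 0%E.
Proof. by rewrite /gauss integral_set0. Qed.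

Let gauss_ge0 A : (0 <= gauss A)%E.
Proof. by apply: integral_ge0 => x _; rewrite lee_fin gauss_pdf_ge0. Qed.

Let gauss_semi_sigma_additive : semi_sigma_additive gauss.
Proof.
move=> /= F mF tF mUF; rewrite /gauss ge0_integral_bigcup//=.
- apply: is_cvg_ereal_nneg_natsum_cond => n _ _; exact: gauss_ge0.
- by apply/measurable_EFinP/measurable_funTS; exact: measurable_gauss_pdf.
- by move=> x _; rewrite lee_fin gauss_pdf_ge0.
Qed.

HB.instance Definition _ := isMeasure.Build _ _ _ gauss
  gauss0 gauss_ge0 gauss_semi_sigma_additive.

Let gauss_sigma_finite : sigma_finite setT gauss.
Proof.
have /sigma_finiteP[F [FT ndF FP]] := sigma_finiteT (@lebn R d).
pose G (i : nat) := [set x | gauss_pdf x <= i%:R].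
have mG i : measurable (G i).
  rewrite -[G i]setTI.
  exact: (measurable_fun_le _ measurable_gauss_pdf (measurable_cst _)).
exists (fun i => F i `&` G i).
  apply/esym; rewrite -subTset => x _.
  have : (\bigcup_i F i) x by rewrite -FT.
  move=> [k _ Fkx]; exists (maxn k (Num.bound (gauss_pdf x))) => //; split.
    by move/subsetPset: (ndF _ _ (leq_maxl k (Num.bound (gauss_pdf x)))); apply.
  rewrite /G /= (le_trans (ltW (archi_boundP (gauss_pdf_ge0 x))))//.
  by rewrite ler_nat leq_maxr.
move=> i; have [mF Fi] := FP i.
have mFG : measurable (F i `&` G i) by exact: measurableI.
split => //; rewrite /gauss.
apply: (@le_lt_trans _ _ (\int[lebn d]_(x in F i `&` G i) (i%:R)%:E)%E).
  apply: ge0_le_integral => //=.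
  - by move=> x _; rewrite lee_fin gauss_pdf_ge0.
  - by apply/measurable_EFinP/measurable_funTS; exact: measurable_gauss_pdf.
  - by move=> x [_ Gx]; rewrite lee_fin.
rewrite integral_cst// lte_mul_pinfty//.
by apply: le_lt_trans Fi; apply: le_measure; rewrite ?inE//; exact: subIsetl.
Qed.

HB.instance Definition _ := Measure_isSigmaFinite.Build _ _ _ gauss
  gauss_sigma_finite.
End gaussian.

Local Open Scope charge_scope.

(* Kullback-Leibler divergence: the integral of log (dmu/dnu) against mu when mu
   is absolutely continuous with respect to nu, and +oo otherwise. *)
Definition KL {R : realType} dT (T : measurableType dT) (mu : probability T R)
    (nu : {sigma_finite_measure set T -> \bar R}) : \bar R :=
  if `[< mu `<< nu >] then
    (\int[mu]_x lne ('d (charge_of_finite_measure mu) '/d nu x))%E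
  else +oo%E.

(* A randomized adaptive algorithm in dimension [d] making [n] queries: its
   internal randomness is a sample from an arbitrary probability space, and both
   the query made after [k] responses and the final output are measurable
   functions of this sample and of the responses received so far (the most
   recent response comes first). Past queries need not be recorded since they
   are themselves functions of the same data. *)
Record algorithm (R : realType) (d n : nat) := Algorithm {
  seed_display : measure_display;
  seed : measurableType seed_display;
  seed_law : probability seed R;
  query : forall k, seed * k.-tuple (d.-tuple R) -> d.-tuple R;
  output : seed * n.-tuple (d.-tuple R) -> d.-tuple R;
  measurable_query : forall k, measurable_fun setT (@query k);
  measurable_output : measurable_fun setT output
}.

Section run.
Context {R : realType} {d n : nat} (A : algorithm R d n) (L : 'M[R]_d).

Fixpoint responses k (w : seed A) : k.-tuple (d.-tuple R) :=
  if k is j.+1 then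
    [tuple of matvec L (query (w, responses j w)) :: responses j w]
  else [tuple].

Definition run (w : seed A) : d.-tuple R := output (w, responses n w).

Lemma measurable_responses k : measurable_fun setT (responses k).
Proof.
elim: k => [|k IH] /=; first exact: measurable_cst.
apply: measurable_cons => //; apply: measurableT_comp.
  exact: measurable_matvec.
by apply: measurableT_comp; [exact: measurable_query|exact: measurable_fun_pair].
Qed.

Lemma measurable_run : measurable_fun setT run.
Proof.
apply: measurableT_comp; first exact: measurable_output.
by apply: measurable_fun_pair => //; exact: measurable_responses.
Qed.

HB.instance Definition _ := isMeasurableFun.Build _ _ _ _ run measurable_run.

Definition output_law : probability (d.-tuple R) R :=
  distribution (seed_law A) run.

End run.

(* Main.v *)
Require Import Defs.
From HB Require Import structures.
From mathcomp Require Import all_boot all_order all_algebra.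
From mathcomp Require Import all_classical all_reals all_analysis.
From mathcomp Require Import measurable_realfun zify lra ring complex.

(* The algorithm outputs [p(L) z] with [z] standard Gaussian and [p] a polynomial
   with [1 - delta <= x p(x)^2 <= 1] on [1, kappa], where [delta <= eps^2 / d] and
   [size p] is of order [sqrt kappa * ln (d / eps)]. The vector [p(L) z] is computed
   either with [size p] Krylov queries or, if [d] is smaller, after learning [L]
   from its action on the canonical basis. Its law is N(0, p(L)^2), and
   [p(L)^2 <= L^-1] makes the exponential factor of the density ratio to
   N(0, L^-1) at most 1; the ratio is thus bounded pointwise by a determinant, which
   is at most [exp (eps^2)], and the same bound holds for the divergence.

   The polynomial is [p = q * s(1 - x q^2)], where [s] truncates the power series
   of [(1 - w)^(-1/2)] and [sqrt x * q] lies between two positive constants. [q] is a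
   sum over the scales [3^j <= sqrt kappa] of the squared Chebyshev-like quotients
   [sin^2 (3^j t) / sin^2 t], with [sin^2 t = x / kappa]. *)

Set Implicit Arguments.
Unset Strict Implicit.
Unset Printing Implicit Defensive.

Import Order.TTheory GRing.Theory Num.Theory.
Local Open Scope ring_scope.

(** * Approximation of the inverse square root *)

Section inverse_sqrt_series.
Variable R : realType.

(** The Taylor coefficients of [(1 - w)^(-1/2)], that is [binom(2n, n) / 4^n]. *)
Fixpoint invsqrt_coef (n : nat) : R :=
  if n is m.+1 then invsqrt_coef m * ((2 * m + 1)%:R / (2 * m.+1)%:R) else 1.

Lemma invsqrt_coef_ge0 n : 0 <= invsqrt_coef n.
Proof. by elim: n => //= n IHn; rewrite mulr_ge0 ?divr_ge0. Qed.

Lemma invsqrt_coefS n :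
  (2 * n.+1)%:R * invsqrt_coef n.+1 = (2 * n + 1)%:R * invsqrt_coef n.
Proof.
rewrite /= mulrCA (mulrCA _ _ (_^-1)) mulfV ?mulr1 ?pnatr_eq0 ?muln_eq0 //.
by rewrite mulrC.
Qed.

(* Weighting the convolution by [2 i] and using the symmetry [i <-> n - i]
   turns the recurrence of the coefficients into [c_(n+1) = c_n]. *)
Lemma invsqrt_coef_convolution n :
  \sum_(i < n.+1) invsqrt_coef i * invsqrt_coef (n - i) = 1.
Proof.
set a := invsqrt_coef.
have sym m : \sum_(i < m.+1) (2 * i)%:R * (a i * a (m - i)%N) =
    m%:R * \sum_(i < m.+1) a i * a (m - i)%N.
  have rev : \sum_(i < m.+1) i%:R * (a i * a (m - i)%N) =
      \sum_(i < m.+1) (m - i)%:R * (a i * a (m - i)%N).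
    rewrite (reindex_inj rev_ord_inj)/=; apply: eq_bigr => i _.
    by rewrite subSS subKn ?(mulrC (a i))// -ltnS.
  under eq_bigr do rewrite mulnC natrM mulr_natr mulr2n mulrDl.
  rewrite big_split/= {1}rev -big_split mulr_sumr; apply: eq_bigr => i _ /=.
  by rewrite -mulrDl -natrD subnK// -ltnS.
elim: n => [|n IHn]; first by rewrite big_ord1 mulr1.
have n1 : n.+1%:R != 0 :> R by rewrite pnatr_eq0.
apply: (mulfI n1); rewrite -sym big_ord_recl muln0 mul0r add0r mulr1.
transitivity (\sum_(i < n.+1) (2 * i + 1)%:R * (a i * a (n - i)%N)).
  apply: eq_bigr => i _; rewrite lift0 subSS [LHS]mulrA [RHS]mulrA; congr (_ * _).
  exact: invsqrt_coefS.
under eq_bigr do rewrite natrD mulrDl mul1r.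
by rewrite big_split/= sym IHn mulr1 natr1.
Qed.

Definition invsqrt_poly k : {poly R} := \poly_(i < k.+1) invsqrt_coef i.

(** The coefficients of the squared truncation all lie in [0, 1], and those of degree at most [k]
    equal 1. The square thus lies between the geometric sums of lengths [k + 1] and [2 k + 2], which
    [1 - w] telescopes. *)
Lemma invsqrt_poly_bounds k (w : R) : 0 <= w <= 1 ->
  1 - w ^+ k.+1 <= (1 - w) * (invsqrt_poly k).[w] ^+ 2 <= 1.
Proof.
move=> /andP[w0 w1]; set p := invsqrt_poly k.
have p0 i : 0 <= p`_i.
  by rewrite coef_poly; case: ifP => // _; exact: invsqrt_coef_ge0.
have pa i : p`_i <= invsqrt_coef i.
  by rewrite coef_poly; case: ifP => // _; exact: invsqrt_coef_ge0.
have c0 n : 0 <= (p * p)`_n.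
  by rewrite coefM sumr_ge0// => i _; rewrite mulr_ge0.
have c1 n : (p * p)`_n <= 1.
  rewrite coefM -(invsqrt_coef_convolution n) ler_sum// => i _.
  by rewrite ler_pM.
have ck n : (n <= k)%N -> (p * p)`_n = 1.
  move=> nk; rewrite coefM -(invsqrt_coef_convolution n); apply: eq_bigr => i _.
  have ik : (i <= k)%N by rewrite (leq_trans _ nk)// -ltnS.
  by rewrite !coef_poly !ltnS ik (leq_trans (leq_subr _ _)).
have sp : (size (p * p)%R <= k.+1 + k.+1)%N.
  rewrite (leq_trans (size_polyMleq _ _))// (leq_trans (leq_pred _))//.
  by rewrite leq_add// size_poly.
have geom m : (1 - w) * \sum_(i < m) w ^+ i = 1 - w ^+ m.
  by rewrite -[1 - w ^+ m]opprB subrX1 -mulNr opprB.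
have -> : p.[w] ^+ 2 = \sum_(i < k.+1 + k.+1) (p * p)`_i * w ^+ i.
  by rewrite expr2 -hornerM (horner_coef_wide _ sp).
apply/andP; split.
  rewrite -geom ler_wpM2l ?subr_ge0// big_split_ord/= -[leLHS]addr0 lerD//.
    by apply: ler_sum => i _; rewrite ck ?mul1r// -ltnS.
  by apply: sumr_ge0 => i _; rewrite mulr_ge0 ?exprn_ge0.
apply: (@le_trans _ _ (1 - w ^+ (k.+1 + k.+1))).
  rewrite -geom ler_wpM2l ?subr_ge0//; apply: ler_sum => i _.
  by rewrite -[leRHS]mul1r ler_wpM2r ?exprn_ge0.
by rewrite gerBl exprn_ge0.
Qed.

Lemma size_invsqrt_poly k : (size (invsqrt_poly k) <= k.+1)%N.
Proof. exact: size_poly. Qed.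

End inverse_sqrt_series.

(* With [x = sin^2 t], [tripling x j = sin^2 (3^j t)], and
   [tripling_factor x j] is its quotient by [x]. *)
Section tripling.

Fixpoint tripling (A : comPzRingType) (x : A) (j : nat) : A :=
  if j is i.+1 then tripling x i * (3 - 4 * tripling x i) ^+ 2 else x.

Definition tripling_factor (A : comPzRingType) (x : A) (j : nat) : A :=
  \prod_(i < j) (3 - 4 * tripling x i) ^+ 2.

(** At [x = t^2] with [0 < t <= 1], the term of index [j] is at most both [3^j] and [1 / (3^j t^2)].
    The scale [3^j] near [1 / t] dominates, so the sum has the order of [1 / t = x^(-1/2)] once that
    scale is included. *)
Definition tripling_sum (R : realType) (x : R) (J : nat) : R :=
  \sum_(j < J) (3 ^+ j)^-1 * tripling_factor x j.

Lemma tripling_factorS (A : comPzRingType) (x : A) j :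
  tripling_factor x j.+1 = tripling_factor x j * (3 - 4 * tripling x j) ^+ 2.
Proof. by rewrite /tripling_factor big_ord_recr. Qed.

Lemma tripling_factorE (A : comPzRingType) (x : A) j :
  tripling x j = x * tripling_factor x j.
Proof.
elim: j => [|j IHj]; first by rewrite /tripling_factor big_ord0 mulr1.
by rewrite tripling_factorS mulrA -IHj.
Qed.

Variable R : realType.
Implicit Types x : R.

Lemma tripling_itv x j : 0 <= x <= 1 -> 0 <= tripling x j <= 1.
Proof.
move=> x01; elim: j => //= j; set v := tripling x j => /andP[v0 v1].
rewrite mulr_ge0 ?sqr_ge0//= -subr_ge0.
(* With [v = sin^2 u], this is [cos^2 (3 u) = cos^2 u * (1 - 4 sin^2 u)^2]. *)
have -> : 1 - v * (3 - 4 * v) ^+ 2 = (1 - v) * (1 - 4 * v) ^+ 2 by ring.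
by rewrite mulr_ge0 ?sqr_ge0// subr_ge0.
Qed.

Lemma tripling_factor_ge0 x j : 0 <= tripling_factor x j.
Proof. by apply: prodr_ge0 => i _; exact: sqr_ge0. Qed.

Lemma tripling_factor_le x j : 0 <= x <= 1 -> tripling_factor x j <= 9 ^+ j.
Proof.
move=> x01; have -> : 9 ^+ j = \prod_(i < j) (9 : R).
  by rewrite prodr_const card_ord.
apply: ler_prod => i _; rewrite sqr_ge0/=.
by have /andP[] := tripling_itv i x01; nra.
Qed.

(** With [s = 9^j x], one tripling multiplies the factor by at least [9 (1 - 8 s / 3)], and
    [(1 - s / 3) (1 - 8 s / 3) >= 1 - 3 s] is the bound at the next scale. Once [s >= 1 / 3] that
    next bound is nonpositive and holds trivially. *)
Lemma tripling_factor_ge x j : 0 <= x <= 1 ->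
  9 ^+ j * (1 - 9 ^+ j * x / 3) <= tripling_factor x j.
Proof.
move=> x01; have /andP[x0 x1] := x01; elim: j => [|j IHj].
  by rewrite /tripling_factor big_ord0 expr0 !mul1r; lra.
have := tripling_factor_le j x01.
have := tripling_factorE x j; have := tripling_factor_ge0 x j.
rewrite tripling_factorS.
move: IHj; set g := tripling_factor x j; set v := tripling x j.
have N0 : 0 < (9 ^+ j : R) by rewrite exprn_gt0.
rewrite exprS; set N := (9 ^+ j : R) in N0 *; move=> gl g0 vE gN.
set s := N * x; have s0 : 0 <= s by rewrite mulr_ge0// ltW.
have vs : v <= s by rewrite vE /s mulrC ler_wpM2r.
rewrite -/s in gl; have -> : 9 * N * x / 3 = 3 * s by rewrite /s; field.
have [s3|s3] := leP (1 / 3) s.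
  apply: (@le_trans _ _ 0); last by rewrite mulr_ge0 ?sqr_ge0.
  by rewrite pmulr_rle0 ?mulr_gt0//; lra.
have h : 9 * (1 - 8 / 3 * s) <= (3 - 4 * v) ^+ 2.
  have -> : (3 - 4 * v) ^+ 2 = 16 * v ^+ 2 + 9 - 24 * v by ring.
  by have := sqr_ge0 v; lra.
apply: (@le_trans _ _ (N * (1 - s / 3) * (9 * (1 - 8 / 3 * s)))).
  rewrite mulrACA (mulrC N) ler_pM2l ?mulr_gt0//.
  by have := sqr_ge0 s; lra.
by rewrite ler_pM// ?mulr_ge0 ?ltW//; lra.
Qed.

Lemma tripling_sum_le (t : R) J : 0 < t <= 1 ->
  t * tripling_sum (t ^+ 2) J <= 3.
Proof.
move=> /andP[t0 t1].
have x01 : 0 <= t ^+ 2 <= 1 by rewrite sqr_ge0/= expr_le1// ltW.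
(* The first bound sums the majorants [3^j t] of the growing terms. In the second,
   [3 / 2 * (3^J t)^-1] reserves the whole geometric tail of the majorants [(3^j t)^-1] for
   [j >= J], which makes the induction close. *)
suff [h1 h2] : t * tripling_sum (t ^+ 2) J <= 3 ^+ J * t / 2 /\
   (1 <= 3 ^+ J * t ->
    t * tripling_sum (t ^+ 2) J <= 3 - 3 / 2 * (3 ^+ J * t)^-1).
  have [/h2 h|h] := leP 1 (3 ^+ J * t); last by lra.
  apply: (le_trans h); rewrite gerBl mulr_ge0// invr_ge0 mulr_ge0 ?exprn_ge0//.
  exact: ltW.
elim: J => [|J [IH1 IH2]].
  rewrite /tripling_sum big_ord0 mulr0 expr0 mul1r; split; first by lra.
  move=> t1'; have -> : t = 1 by lra.
  by rewrite invr1; lra.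
rewrite /tripling_sum big_ord_recr/= -/(tripling_sum _ J) mulrDr.
have T0 : 0 < (3 ^+ J : R) by rewrite exprn_gt0.
have a1 : t * ((3 ^+ J)^-1 * tripling_factor (t ^+ 2) J) <= 3 ^+ J * t.
  rewrite mulrC ler_pM2r// ler_pdivrMl// -expr2 exprAC.
  by rewrite (le_trans (tripling_factor_le J x01))// expr2 -natrM.
have a2 : t * ((3 ^+ J)^-1 * tripling_factor (t ^+ 2) J) <= (3 ^+ J * t)^-1.
  rewrite invfM mulrCA ler_pM2l ?invr_gt0// -(ler_pM2l t0) mulfV ?gt_eqF//.
  rewrite mulrA -expr2 -tripling_factorE.
  by have /andP[] := tripling_itv J x01.
have -> : 3 ^+ J.+1 * t = 3 * (3 ^+ J * t) by rewrite exprS mulrA.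
move: a1 a2 IH1 IH2.
set e := t * (_ * tripling_factor _ _); set b := t * tripling_sum _ _.
set s := 3 ^+ J * t => a1 a2 IH1 IH2.
have s0 : 0 < s by rewrite mulr_gt0.
split; first by lra.
move=> s1; rewrite invfM; have [/IH2 h|h] := leP 1 s.
  by rewrite (_ : _ / 2 * _ = s^-1 / 2); [lra | field; rewrite gt_eqF].
(* Crossing between the two regimes: here [1 / 3 <= s < 1], so only the first bound is available for
   the previous terms. *)
have h2 : b + e <= 3 * s / 2 by lra.
apply: (le_trans h2); rewrite lerBrDr -(ler_pM2l s0) mulrDr.
rewrite (_ : s * (3 / 2 * _) = 1 / 2); first by nra.
by field; rewrite gt_eqF.
Qed.

(** A single term suffices, that of the last scale with [s = 3^j t <= 1]. There [s > 1 / 3], and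
    [tripling_factor_ge] makes the term at least [2 s / 3]; the other terms are nonnegative. *)
Lemma tripling_sum_ge (t : R) J : 0 < t <= 1 -> 1 < 3 ^+ J * t ->
  2 / 9 <= t * tripling_sum (t ^+ 2) J.
Proof.
move=> /andP[t0 t1].
have x01 : 0 <= t ^+ 2 <= 1 by rewrite sqr_ge0/= expr_le1// ltW.
elim: J => [|J IHJ] s1; first by move: s1; rewrite expr0 mul1r; lra.
rewrite /tripling_sum big_ord_recr/= -/(tripling_sum _ J) mulrDr.
have T0 : 0 < (3 ^+ J : R) by rewrite exprn_gt0.
have [h|h] := ltP 1 (3 ^+ J * t).
  rewrite (le_trans (IHJ h))// lerDl (mulr_ge0 (ltW t0))// mulr_ge0//.
  exact: tripling_factor_ge0.
have b0 : 0 <= t * tripling_sum (t ^+ 2) J.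
  rewrite (mulr_ge0 (ltW t0))// sumr_ge0// => i _.
  by rewrite mulr_ge0 ?tripling_factor_ge0// invr_ge0 exprn_ge0.
rewrite -[leLHS]add0r lerD//; set s := 3 ^+ J * t in h.
have s3 : 1 < 3 * s by rewrite mulrA -exprS.
have e : 9 ^+ J * t ^+ 2 = s ^+ 2 :> R.
  by rewrite /s exprMn exprAC -(natrX _ 3 2).
have g : 9 ^+ J * (2 / 3) <= tripling_factor (t ^+ 2) J.
  apply: le_trans (tripling_factor_ge J x01).
  by rewrite ler_pM2l ?exprn_gt0// e; nra.
apply: (@le_trans _ _ (t * ((3 ^+ J)^-1 * (9 ^+ J * (2 / 3))))); last first.
  by rewrite ler_pM2l// ler_pM2l// invr_gt0.
rewrite (_ : 9 ^+ J = 3 ^+ J * 3 ^+ J); last by rewrite -exprMn -natrM.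
rewrite -mulrA mulKf ?gt_eqF//.
have -> : t * (3 ^+ J * (2 / 3)) = s * (2 / 3).
  by rewrite (mulrCA t) (mulrA (3 ^+ J)) -/s.
by lra.
Qed.


(** * Evaluation and degree of the tripling polynomials *)

Lemma horner_tripling (p : {poly R}) x j :
  (tripling p j).[x] = tripling p.[x] j.
Proof. by elim: j => //= j <-; rewrite -!polyC_natr !hornerE. Qed.

Lemma horner_tripling_factor (p : {poly R}) x j :
  (tripling_factor p j).[x] = tripling_factor p.[x] j.
Proof.
rewrite horner_prod; apply: eq_bigr => i _.
by rewrite -!polyC_natr !hornerE horner_tripling.
Qed.

Lemma size_sqr_le (p : {poly R}) m :
  (size p <= m.+1 -> size (p ^+ 2) <= (2 * m).+1)%N.
Proof.
move=> pm; rewrite expr2 (leq_trans (size_polyMleq _ _))//.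
rewrite mul2n -addnn -ltnS; case: (size p) pm => // n nm.
by rewrite addSn /= addnS !ltnS leq_add.
Qed.

Lemma size_tripling_step (p : {poly R}) m :
  (size p <= m.+1 -> size ((3 - 4 * p) ^+ 2)%R <= (2 * m).+1)%N.
Proof.
move=> pm; apply: size_sqr_le; rewrite (leq_trans (size_polyD _ _))// geq_max.
rewrite size_polyN -!polyC_natr (leq_trans (size_polyC_leq1 _))//=.
rewrite (leq_trans (size_polyMleq _ _))//.
by rewrite (leq_trans _ pm)// -subn1 leq_subLR leq_add2r size_polyC_leq1.
Qed.

Lemma size_tripling (p : {poly R}) j : (size p <= 2)%N ->
  (size (tripling p j) <= (3 ^ j).+1)%N /\
  (size (tripling_factor p j) <= 3 ^ j)%N.
Proof.
move=> p2; elim: j => [|j [IH1 IH2]].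
  by rewrite /tripling_factor big_ord0 size_poly1 expn0.
have h := size_tripling_step IH1.
rewrite tripling_factorS /=.
rewrite expnS.
split; rewrite (leq_trans (size_polyMleq _ _))// -subn1 leq_subLR.
  by rewrite (leq_trans (leq_add IH1 h))//; lia.
by rewrite (leq_trans (leq_add IH2 h))//; lia.
Qed.

End tripling.

(* [q] approximates [x^(-1/2)] up to a constant factor on [1, kappa]; the
   degree of [1 / sqrt(1 - w)] then only sees the resulting constant gap. *)
Lemma inverse_sqrt_approximation (R : realType) (kappa : R) (k : nat) :
  1 <= kappa -> exists p : {poly R},
  (size p)%:R <= (2 * k + 1)%:R * Num.sqrt kappa /\
  forall x, 1 <= x <= kappa ->
    1 - (725 / 729) ^+ k.+1 <= x * p.[x] ^+ 2 <= 1.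
Proof.
move=> kap1; have kap0 : 0 < kappa by rewrite (lt_le_trans _ kap1).
set M := Num.sqrt kappa.
have M2 : M ^+ 2 = kappa by rewrite sqr_sqrtr// ltW.
have M0 : 0 < M by rewrite sqrtr_gt0.
have M1 : 1 <= M by rewrite -[leLHS]sqrtr1 ler_wsqrtr.
have exJ : exists J, M < 3 ^+ J.
  exists (Num.bound M); rewrite (lt_trans (archi_boundP (ltW M0)))//.
  by rewrite -natrX ltr_nat ltn_expl.
(* [J] is the last scale with [3^J <= sqrt kappa]: the degree stays below [sqrt kappa], while
   [3^(J+1) t > 1] for every [t >= 1 / sqrt kappa], as [tripling_sum_ge] requires. *)
have [[|J] MJ minJ] := ex_minnP exJ.
  by move: MJ; rewrite expr0 ltNge M1.
have JM : 3 ^+ J <= M.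
  by rewrite leNgt; apply/negP => /minJ; rewrite ltnn.
pose X := kappa^-1 *: 'X : {poly R}.
have X2 : (size X <= 2)%N by rewrite (leq_trans (size_scale_leq _ _))// size_polyX.
pose b := \sum_(j < J.+1) (3 ^+ j)^-1 *: tripling_factor X j.
have sb : (size b <= 3 ^ J)%N.
  rewrite (leq_trans (size_sum _ _ _))//; apply/bigmax_leqP => i _.
  rewrite (leq_trans (size_scale_leq _ _))//.
  rewrite (leq_trans (size_tripling i X2).2)// leq_exp2l//.
  by rewrite -ltnS.
(* [M] undoes the rescaling of [x] by [kappa], and 3 is the bound of [tripling_sum_le], so that
   [sqrt x * q] is at most 1 on [1, kappa]. *)
pose q := (3 * M)^-1 *: b.
have sq : (size q <= 3 ^ J)%N by rewrite (leq_trans (size_scale_leq _ _)).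
pose r := 1 - 'X * q ^+ 2.
have N0 : (0 < 3 ^ J)%N by rewrite expn_gt0.
have sr : (size r <= 2 * 3 ^ J)%N.
  rewrite (leq_trans (size_polyD _ _))// geq_max size_poly1 size_polyN.
  rewrite muln_gt0 N0/= (leq_trans (size_polyMleq _ _))// size_polyX.
  have sq2 : (size (q ^+ 2)%R <= (2 * (3 ^ J).-1).+1)%N.
    by apply: size_sqr_le; rewrite prednK.
  by rewrite add2n (leq_ltn_trans sq2)//; lia.
exists (q * (invsqrt_poly R k \Po r)); split.
  apply: (@le_trans _ _ ((2 * k + 1) * 3 ^ J)%N%:R); last first.
    by rewrite natrM ler_wpM2l// natrX.
  rewrite ler_nat (leq_trans (size_polyMleq _ _))//.
  have sc : (size (invsqrt_poly R k \Po r) <= (k * (2 * 3 ^ J)).+1)%N.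
    rewrite (leq_trans (size_comp_poly_leq _ _))// ltnS leq_mul//.
      by rewrite -subn1 leq_subLR add1n size_invsqrt_poly.
    by rewrite (leq_trans (leq_pred _)).
  by rewrite -subn1 leq_subLR (leq_trans (leq_add sq sc))//; nia.
move=> x /andP[x1 xk].
have x0 : 0 < x by rewrite (lt_le_trans _ x1).
pose t := Num.sqrt x / M.
have t2 : t ^+ 2 = x / kappa by rewrite exprMn exprVn M2 sqr_sqrtr// ltW.
have t0 : 0 < t by rewrite divr_gt0// sqrtr_gt0.
have t1 : t <= 1 by rewrite ler_pdivrMr// mul1r ler_wsqrtr.
have t01 : 0 < t <= 1 by rewrite t0.
have bE : b.[x] = tripling_sum (t ^+ 2) J.+1.
  rewrite horner_sum; apply: eq_bigr => i _.
  by rewrite hornerZ horner_tripling_factor hornerZ hornerX t2 (mulrC kappa^-1).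
have tJ : 1 < 3 ^+ J.+1 * t.
  rewrite mulrA ltr_pdivlMr// mul1r (lt_le_trans MJ)// ler_peMr ?exprn_ge0//.
  by rewrite -[leLHS]sqrtr1 ler_wsqrtr.
have lo := tripling_sum_ge t01 tJ; have hi := tripling_sum_le J.+1 t01.
rewrite -bE in lo hi.
have qE : x * q.[x] ^+ 2 = (t * b.[x] / 3) ^+ 2.
  have xE : x = (t * M) ^+ 2 by rewrite /t divfK ?gt_eqF// sqr_sqrtr// ltW.
  by rewrite hornerZ {1}xE; field; rewrite gt_eqF.
have rE : r.[x] = 1 - x * q.[x] ^+ 2 by rewrite !hornerE.
(* [725 / 729 = 1 - (2 / 27)^2], where [2 / 27] is the constant [2 / 9] of [tripling_sum_ge] divided
   by the normalisation 3. *)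
have w01 : 0 <= r.[x] <= 725 / 729.
  rewrite rE qE; set y := t * b.[x] / 3.
  have yge : 2 / 27 <= y by rewrite /y; lra.
  have yle : y <= 1 by rewrite /y; lra.
  have ysq : 4 / 729 <= y ^+ 2.
    rewrite (_ : 4 / 729 = (2 / 27) ^+ 2); last by field.
    by rewrite lerXn2r// ?nnegrE ?(le_trans _ yge)//; lra.
  have y1 : y ^+ 2 <= 1 by rewrite expr_le1// (le_trans _ yge)//; lra.
  by rewrite subr_ge0 y1/=; lra.
rewrite hornerM horner_comp [X in x * X]exprMn mulrA.
have -> : x * q.[x] ^+ 2 = 1 - r.[x] by rewrite rE opprB addrCA subrr addr0.
have w1 : 0 <= r.[x] <= 1 by case/andP: w01 => -> /=; lra.
have /andP[lo' ->] := invsqrt_poly_bounds k w1; rewrite andbT.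
case/andP: w01 => w0 wr; apply: le_trans lo'.
by rewrite lerD2l lerN2; apply: lerXn2r; rewrite ?nnegrE ?(le_trans w0 wr).
Qed.

(** * Polynomials of a symmetric matrix *)

Section symmetric_functional_calculus.
Variables (R : realType) (n : nat) (L : 'M[R]_n.+1).
Hypothesis symL : L^T = L.

Local Notation toC := (real_complex R).
Local Notation LC := (map_mx toC L).
Local Notation U := (spectralmx LC).
Local Open Scope sesquilinear_scope.

Let real_toC (x : R) : toC x \is Num.real.
Proof. by apply/complex_realP; exists x. Qed.

Let conj_toC (x : R) : (toC x)^* = toC x.
Proof. exact/CrealP/real_toC. Qed.

Let hermLC : LC \is hermsymmx.
Proof.
apply: realsym_hermsym.
  apply/is_hermitianmxP; rewrite expr0 scale1r.
  by rewrite map_mx_id// map_trmx symL.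
by apply/mxOverP => i j; rewrite mxE.
Qed.

(** The complexification of [L] is hermitian, so its spectral diagonal is real and taking real parts
    loses nothing. *)
Definition spectral_value (i : 'I_n.+1) : R := complex.Re (spectral_diag LC 0 i).

Let spectral_diagE i : spectral_diag LC 0 i = toC (spectral_value i).
Proof.
have /mxOverP/(_ 0 i)/complex_realP[k kE] := hermitian_spectral_diag_real hermLC.
by rewrite /spectral_value kE.
Qed.

Let LCE : LC = invmx U *m diag_mx (spectral_diag LC) *m U.
Proof. exact/orthomx_spectralP/hermitian_normalmx. Qed.

(** Being a root of the characteristic polynomial descends from the complexification to [L]; over
    the complex numbers, row [i] of [U] is an eigenvector. *)
Lemma eigenvalue_spectral_value i : eigenvalue L (spectral_value i).
Proof.
rewrite eigenvalue_root_char -(fmorph_root toC) map_char_poly /= -spectral_diagE.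
rewrite -eigenvalue_root_char; apply/eigenvalueP.
exists (row i U); last first.
  apply/eqP => /(congr1 (mulmx^~ (invmx U))); rewrite mul0mx -row_mul.
  rewrite mulmxV ?spectral_unit// => /rowP/(_ i)/eqP.
  by rewrite !mxE eqxx oner_eq0.
have := LCE; have := spectral_unit LC.
move: U (spectral_diag LC) => u D uU {1}->.
rewrite -row_mul !mulmxA mulmxV// mul1mx.
by apply/rowP => j; rewrite mul_diag_mx !mxE.
Qed.

Let horner_LC (g : {poly R}) : map_mx toC (horner_mx L g) =
  invmx U *m diag_mx (\row_i toC g.[spectral_value i]) *m U.
Proof.
rewrite map_horner_mx.
have -> : \row_i toC g.[spectral_value i] =
    map_mx (horner (map_poly toC g)) (spectral_diag LC).
  by apply/rowP => i; rewrite !mxE spectral_diagE horner_map.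
have := LCE; have := spectral_unit LC.
move: U (spectral_diag LC) => u D uU ->.
by rewrite -horner_mx_diag horner_mx_uconjC.
Qed.

Lemma det_horner_mx (g : {poly R}) :
  \det (horner_mx L g) = \prod_i g.[spectral_value i].
Proof.
apply: (@complexI R); rewrite -det_map_mx horner_LC !det_mulmx mulrAC.
rewrite -det_mulmx mulVmx ?spectral_unit// det1 mul1r det_diag rmorph_prod.
by apply: eq_bigr => i _; rewrite mxE.
Qed.

(** In the unitary coordinates [w = U v] the form is the sum of [g(lambda_i) |w_i|^2], to be
    compared with the sum of [|w_i|^2]. *)
Lemma horner_mx_form_le (g : {poly R}) (v : 'cV[R]_n.+1) :
  (forall i, g.[spectral_value i] <= 1) ->
  (v^T *m horner_mx L g *m v) 0 0 <= (v^T *m v) 0 0.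
Proof.
move=> g1; rewrite -(lecR (_ 0 0)).
pose vC := map_mx toC v; pose w := U *m vC.
have wE : w^t* = map_mx toC v^T *m invmx U.
  rewrite invmx_unitary ?spectral_unitarymx// /w trmx_mul map_mxM.
  congr (_ *m _); apply/matrixP => i j; rewrite !mxE.
  exact: conj_toC.
have toC00 (A : 'M[R]_1) : toC (A 0 0) = (map_mx toC A) 0 0 by rewrite mxE.
rewrite !toC00 !map_mxM horner_LC !mulmxA -wE -mulmxA -/w.
have -> : map_mx toC v^T *m map_mx toC v = w^t* *m w.
  by rewrite wE mulmxA mulmxKV ?spectral_unit.
rewrite !mxE; apply: ler_sum => i _; rewrite mul_mx_diag !mxE mulrAC.
rewrite -[leRHS]mulr1 ler_wpM2l//; first by rewrite mulrC mul_conjC_ge0.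
by rewrite lecR.
Qed.

Lemma trmx_horner_mx (g : {poly R}) : (horner_mx L g)^T = horner_mx L g.
Proof.
elim/poly_ind: g => [|g c IHg]; first by rewrite rmorph0 trmx0.
rewrite rmorphD rmorphM/= horner_mx_X horner_mx_C linearD/= tr_scalar_mx.
by rewrite trmx_mul IHg symL; congr (_ + _); exact: comm_mx_horner.
Qed.

End symmetric_functional_calculus.

(** * Linear changes of variables *)

Section lebesgue_affine.
Variable R : realType.
Local Open Scope classical_set_scope.
Local Notation leb := (@lebesgue_measure R).

Let affine (a b : R) (x : measurableTypeR R) : measurableTypeR R := a * x + b.

Let measurable_affine a b : measurable_fun setT (affine a b).
Proof. by apply: measurable_funD => //; exact: measurable_funM. Qed.

Let affine_ocitv (a b : R) (X : set R) : a != 0 -> ocitv X ->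
  leb X = (`|a|%:E * leb (affine a b @^-1` X))%E.
Proof.
move=> a0 [[u v] _ <-] /=; have [apos|aneg] := ltP 0 a.
  have -> : affine a b @^-1` `]u, v] = `](u - b) / a, (v - b) / a].
    apply/seteqP; split => x /=; rewrite !in_itv/= ltr_pdivrMr//;
    by rewrite ler_pdivlMr// ltrBlDr lerBrDr (mulrC x).
  rewrite !lebesgue_measure_itv/= !lte_fin ltr_pM2r ?invr_gt0// ltrD2r.
  case: ifP => _; last by rewrite mule0.
  rewrite gtr0_norm// -!EFinB -EFinM; congr EFin.
  by field; rewrite gt_eqF.
have {aneg}aneg : a < 0 by rewrite lt_neqAle a0.
have -> : affine a b @^-1` `]u, v] = `[(v - b) / a, (u - b) / a[.
  apply/seteqP; split => x /=; rewrite !in_itv/= ler_ndivrMr//;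
  by rewrite ltr_ndivlMr// ltrBlDr lerBrDr (mulrC x) andbC.
rewrite !lebesgue_measure_itv/= !lte_fin ltr_nM2r ?invr_lt0// ltrD2r.
case: ifP => _; last by rewrite mule0.
rewrite ltr0_norm// -!EFinB -EFinM; congr EFin.
by field.
Qed.

(** Lebesgue measure and [|a|] times its pushforward by the affine map agree on half-open intervals,
    hence everywhere by uniqueness. *)
Lemma ge0_integral_affine (a b : R) (f : R -> \bar R) : a != 0 ->
  measurable_fun setT f -> (forall x, 0 <= f x)%E ->
  (`|a|%:E * \int[leb]_x f (a * x + b)%R = \int[leb]_x f x)%E.
Proof.
move=> a0 mf f0.
pose P0 : {measure set _ -> \bar R} := pushforward leb (affine a b).
pose P := P0 (measurable_affine a b).
pose Q := mscale (NngNum (normr_ge0 a)) P.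
have -> : (\int[leb]_x f x = \int[Q]_x f x)%E.
  apply: eq_measure_integral => A mA _; apply: lebesgue_measure_unique => //.
  by move=> X oX; exact: affine_ocitv.
by rewrite ge0_integral_mscale//= ge0_integral_pushforward.
Qed.

End lebesgue_affine.

Section lebn_linear_change.
Variable R : realType.
Local Open Scope classical_set_scope.
Local Notation leb := (@lebesgue_measure R).

Definition cotuple n (u : 'cV[R]_n) : n.-tuple R := [tuple u i 0 | i < n].

Lemma colvK n : cancel (@colv R n) (@cotuple n).
Proof. by move=> x; apply: eq_from_tnth => i; rewrite tnth_mktuple mxE. Qed.

Lemma cotupleK n : cancel (@cotuple n) (@colv R n).
Proof. by move=> u; apply/colP => i; rewrite mxE tnth_mktuple. Qed.

Lemma matvec_cotuple n (M : 'M[R]_n) x : matvec M x = cotuple (M *m colv x).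
Proof. by []. Qed.

Lemma colv_matvec n (M : 'M[R]_n) x : colv (matvec M x) = M *m colv x.
Proof. by rewrite matvec_cotuple cotupleK. Qed.

Lemma consv_cotuple n (a : R) (u : 'cV[R]_n) :
  consv (a, cotuple u) = cotuple (col_mx a%:M u : 'cV_(1 + n)).
Proof.
apply: eq_from_tnth => i; rewrite [RHS]tnth_mktuple.
case: (split_ordP (i : 'I_(1 + n))) => k ->.
  by rewrite col_mxEu (ord1 k) mxE eqxx.
rewrite col_mxEd (_ : rshift 1 k = lift ord0 k :> 'I_n.+1); last exact/val_inj.
by rewrite tnthS tnth_mktuple.
Qed.

Lemma colv_consv n (a : R) x :
  colv (consv (a, x)) = col_mx a%:M (colv x) :> 'cV_(1 + n).
Proof. by rewrite -{1}(colvK x) consv_cotuple cotupleK. Qed.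

Lemma measurable_cotuple d (T : measurableType d) n (h : T -> 'cV[R]_n) :
  (forall i, measurable_fun setT (fun t => h t i 0)) ->
  measurable_fun setT (fun t => cotuple (h t)).
Proof.
move=> mh; apply/measurable_fun_tnthP => i.
by rewrite (_ : _ \o _ = fun t => h t i 0)//; apply/funext => t /=;
  rewrite tnth_mktuple.
Qed.

Lemma measurable_linear_form d (T : measurableType d) n (M : 'rV[R]_n)
    (h : T -> n.-tuple R) : measurable_fun setT h ->
  measurable_fun setT (fun t => (M *m colv (h t)) 0 0).
Proof.
move=> mh; under eq_fun do rewrite mxE; apply: measurable_sum => i.
under eq_fun do rewrite mxE; apply: measurable_funM => //.
by apply: (measurableT_comp (measurable_tnth i)).
Qed.

Lemma measurable_affine_map n (M : 'M[R]_n) (v : 'cV[R]_n) :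
  measurable_fun setT (fun x => cotuple (M *m colv x + v)).
Proof.
apply: measurable_cotuple => i; under eq_fun do rewrite mxE.
apply: measurable_funD => //.
rewrite (_ : (fun x => _) = (fun x => (row i M *m colv x) 0 0)).
  exact: measurable_linear_form.
by apply/funext => x; rewrite -row_mul [RHS]mxE.
Qed.

Local Open Scope ereal_scope.

Lemma integral_lebnS n (f : n.+1.-tuple R -> \bar R) :
  measurable_fun setT f -> (forall x, 0 <= f x) ->
  \int[lebn n.+1]_x f x = \int[leb \x lebn n]_p f (consv p).
Proof.
move=> mf f0.
pose P0 : {measure set _ -> \bar R} := pushforward (leb \x @lebn R n) (@consv R n).
pose P := P0 (@measurable_consv R n).
transitivity (\int[P]_x f x); first exact: eq_measure_integral.
by rewrite ge0_integral_pushforward//; exact: measurable_consv.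
Qed.

(** The translation [v] is what lets the induction on the dimension run: a coordinate held fixed
    enters the remaining ones as a shift. *)
Definition affine_invariance n := forall (M : 'M[R]_n) (v : 'cV[R]_n) f,
  \det M != 0%R -> measurable_fun setT f -> (forall x, 0 <= f x) ->
  `|\det M|%:E * \int[lebn n]_x f (cotuple (M *m colv x + v)%R) =
  \int[lebn n]_x f x.

Let det_schur n (A : 'M[R]_1) B C (D : 'M[R]_n) : (A 0 0 != 0)%R ->
  (\det (block_mx A B C D) =
   A 0 0 * \det (D - (A 0 0)^-1 *: (C *m B)))%R.
Proof.
move=> a0; set S := (_ - _)%R.
have -> : block_mx A B C D =
    (block_mx 1%:M 0 ((A 0 0)^-1 *: C) 1%:M *m block_mx A B 0 S)%R.
  rewrite mulmx_block !mul1mx !mul0mx !addr0.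
  rewrite -!scalemxAl /S addrC subrK; congr block_mx.
  by rewrite [A in (C *m A)%R]mx11_scalar mul_mx_scalar scalerA mulVf// scale1r.
rewrite det_mulmx det_lblock det_ublock !det1 !mul1r.
by rewrite {1}[A]mx11_scalar det_scalar1.
Qed.

(* One step of Gaussian elimination: the first output coordinate is substituted
   in the one-dimensional integral, and the remaining ones are an affine image of
   the remaining inputs by the Schur complement. *)
Lemma affine_invariance_pivot n (M : 'M[R]_(1 + n)) (v : 'cV[R]_(1 + n)) f :
  affine_invariance n -> (M 0 0 != 0)%R ->
  \det M != 0%R -> measurable_fun setT f -> (forall x, 0 <= f x) ->
  `|\det M|%:E * \int[lebn (1 + n)]_x f (cotuple (M *m colv x + v)%R) =
  \int[lebn (1 + n)]_x f x.
Proof.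
move=> IH; have -> : (M 0 0 = ulsubmx M 0 0)%R by rewrite !mxE !lshift0.
rewrite -{2 3 4}[M]submxK -[v]vsubmxK.
move: (ulsubmx M) (ursubmx M) (dlsubmx M) (drsubmx M) => A B C D.
move: (usubmx v) (dsubmx v) => v0 v1 a0; rewrite det_schur//.
set a := (A 0 0)%R in a0 *; set b := (v0 0 0)%R.
set S := (D - _)%R; rewrite mulf_eq0 negb_or => /andP[_ S0] mf f0.
(* Solving [s = a t + B x + b] for [t] turns the lower coordinates [C t + D x + v1] into
   [S x + w s]. *)
pose w (s : R) := ((s / a) *: C - (b / a) *: C + v1)%R.
pose G (p : R * n.-tuple R) :=
  f (cotuple (block_mx A B C D *m colv (consv p) + col_mx v0 v1)%R).
pose H (p : R * n.-tuple R) :=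
  f (consv (p.1, cotuple (S *m colv p.2 + w p.1)%R)).
have mG : measurable_fun setT G.
  apply: measurableT_comp => //.
  apply: (measurableT_comp (@measurable_affine_map _ _ _)).
  exact: measurable_consv.
have G0 p : 0 <= G p := f0 _.
have mH : measurable_fun setT H.
  apply: measurableT_comp => //.
  apply: measurable_cons => /=; first exact: measurable_fst.
  apply: measurable_cotuple => i.
  rewrite (_ : (fun _ => _) =
      (fun p : R * n.-tuple R => (row i S *m colv p.2) 0 0 + w p.1 i 0)%R).
    apply: measurable_funD; first exact: measurable_linear_form.
    rewrite /w; under eq_fun do rewrite !mxE.
    do 2 apply: measurable_funD => //.
    by apply: measurable_funM => //; exact: measurable_funM.
  by apply/funext => p; rewrite mxE -row_mul [in RHS]mxE.
have H0 p : 0 <= H p := f0 _.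
have GE t x : G (t, x) = H ((a * t + ((B *m colv x) 0 0 + b))%R, x).
  rewrite /G /H /= colv_consv mul_block_col add_col_mx consv_cotuple.
  congr (f (cotuple (col_mx _ _))).
    apply/matrixP => i j; rewrite !ord1 /a /b mul_mx_scalar.
    by rewrite !mxE eqxx mulr1n mulrC addrA.
  rewrite /S mulmxBl -scalemxAl -(mulmxA C) /w mul_mx_scalar.
  rewrite [(B *m colv x)%R]mx11_scalar mul_mx_scalar; move: (B *m colv x)%R => Bx.
  apply/colP => i; rewrite !mxE eqxx mulr1n; field; exact: a0.
rewrite integral_lebnS//; last first.
  exact: (measurableT_comp mf (@measurable_affine_map _ _ _)).
rewrite -/G normrM mulrC EFinM -muleA fubini_tonelli2//.
rewrite -ge0_integralZl_EFin//; last first.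
- exact: measurable_fun_fubini_tonelli_G.
- by move=> x _; exact: integral_ge0.
rewrite (eq_integral (fun x => \int[leb]_s H (s, x))); last first.
  move=> x _; rewrite -(ge0_integral_affine ((B *m colv x) 0 0 + b)%R a0)//.
    by congr (_ * _); apply: eq_integral => t _; exact: GE.
  exact: measurableT_comp.
rewrite -fubini_tonelli// -ge0_integralZl_EFin//; last first.
- exact: measurable_fun_fubini_tonelli_F.
- by move=> s _; exact: integral_ge0.
rewrite integral_lebnS// fubini_tonelli1//; last first.
  by apply: measurableT_comp => //; exact: measurable_consv.
apply: eq_integral => s _; rewrite /fubini_F.
apply: (IH S (w s) (fun y => f (consv (s, y)))) => //.
apply: measurableT_comp => //.
by apply: measurable_cons; [exact: measurable_cst|exact: measurable_id].
Qed.

(** If the pivot vanishes, some lower entry of the first column does not, and adding its row to the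
    first ([E 1]) creates a pivot. The inverse transvection [E (-1)] has pivot 1, so the pivot case
    covers both factors of [M = E (-1) (E 1 M)]. *)
Lemma affine_invarianceT n : affine_invariance n.
Proof.
elim: n => [M v f _ mf f0|n IH M v f M0 mf f0].
  rewrite det_mx00 normr1 mul1e; apply: eq_integral => x _.
  by congr f; rewrite [LHS]tuple0 [RHS]tuple0.
have [M00|] := eqVneq (M 0 0)%R 0%R; last first.
  by move=> M00; exact: (@affine_invariance_pivot n M v).
have [j Mj] : exists j : 'I_n, (M (lift ord0 j) 0 != 0)%R.
  apply/existsP; apply: contraNT M0; rewrite negb_exists => /forallP h.
  rewrite (expand_det_col _ ord0) big_ord_recl M00 mul0r add0r big1// => i _.
  by have /negPn/eqP -> := h i; rewrite mul0r.
pose E s : 'M[R]_(1 + n) := block_mx 1%:M (s *: delta_mx 0 j)%R 0%R 1%:M.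
have detE s : \det (E s) = 1%R by rewrite det_ublock !det1 mulr1.
have EK : (E (- 1) *m E 1 = 1%:M)%R.
  rewrite mulmx_block !mul1mx !mulmx0 !mul0mx mulmx1 !addr0 add0r scale1r scaleN1r.
  by rewrite subrr -scalar_mx_block.
have EM00 : ((E 1 *m (M : 'M[R]_(1 + n))) 0 0 != 0)%R.
  rewrite mxE big_split_ord/= big_ord1.
  have -> : (0%R : 'I_(1 + n)) = lshift n 0%R by exact/val_inj.
  rewrite block_mxEul mxE eqxx mul1r.
  rewrite (bigD1 j)//= block_mxEur !mxE !eqxx !mulr1 mul1r big1 ?addr0.
    rewrite (_ : lshift n 0%R = 0%R); last exact/val_inj.
    rewrite M00 add0r (_ : rshift 1 j = lift ord0 j)//; exact/val_inj.
  move=> k kj; rewrite block_mxEur !mxE eqxx (negbTE kj) mulr0 mul0r//.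
pose g x := f (cotuple (E (-1) *m colv x + 0)%R).
have mg : measurable_fun setT g.
  exact: (measurableT_comp mf (@measurable_affine_map _ _ _)).
have detEM : \det (E 1 *m M)%R = \det M.
  by rewrite [LHS](@det_mulmx R (1 + n)) detE mul1r.
have g0 x : 0 <= g x := f0 _.
transitivity (\int[lebn (1 + n)]_x g x).
  rewrite -(@affine_invariance_pivot n (E 1 *m M)%R (E 1 *m v)%R g) ?detEM//.
  congr (_ * _); apply: eq_integral => x _.
  by rewrite /g cotupleK addr0 -mulmxA -mulmxDr mulmxA EK mul1mx.
rewrite -[RHS](@affine_invariance_pivot n (E (-1)%R) 0%R f)// ?detE ?oner_eq0//.
  by rewrite normr1 mul1e.
rewrite (_ : (0%R : 'I_(1 + n)) = lshift n 0%R); last exact/val_inj.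
by rewrite block_mxEul mxE eqxx oner_eq0.
Qed.

Lemma ge0_integral_linear n (M : 'M[R]_n) (f : n.-tuple R -> \bar R) :
  \det M != 0%R -> measurable_fun setT f -> (forall x, 0 <= f x) ->
  `|\det M|%:E * \int[lebn n]_x f (matvec M x) = \int[lebn n]_x f x.
Proof.
move=> M0 mf f0; rewrite -[RHS](@affine_invarianceT n M 0%R)//; congr (_ * _).
by apply: eq_integral => x _; rewrite addr0.
Qed.

End lebn_linear_change.

(** * Divergence and density bounds *)

Section KL_bound.
Context {R : realType} dT (T : measurableType dT).
Variables (mu : probability T R) (nu : {sigma_finite_measure set T -> \bar R}).
Local Open Scope classical_set_scope.
Local Open Scope ereal_scope.
Local Open Scope charge_scope.

Lemma measurable_lne_fin_num (f : T -> \bar R) :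
  measurable_fun setT f -> (forall x, f x \is a fin_num) ->
  measurable_fun setT (fun x => lne (f x)).
Proof.
move=> mf ffin.
rewrite (_ : (fun x => lne (f x)) = (fun x =>
    if (fine (f x) <= 0)%R then -oo else (ln (fine (f x)))%:E)); last first.
  by apply/funext => x; rewrite -{1}(fineK (ffin x)).
have mff : measurable_fun setT (fun x => fine (f x)).
  exact: measurableT_comp.
apply: measurable_fun_ifT => //; first exact: measurable_fun_ler.
by apply/measurable_EFinP; apply: measurableT_comp => //; exact: measurable_ln.
Qed.

Variable c : R.
Hypothesis c0 : (0 <= c)%R.
Hypothesis mu_le : forall A, measurable A -> mu A <= (expR c)%:E * nu A.

Let dom : mu `<< nu.
Proof.
apply/null_content_dominatesP => A mA nuA0; apply/eqP.
by rewrite eq_le measure_ge0 andbT (le_trans (mu_le mA))// nuA0 mule0.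
Qed.

Let cdom : charge_of_finite_measure mu `<< nu.
Proof. exact: dom. Qed.

Let f := 'd (charge_of_finite_measure mu) '/d nu.

Let mf : measurable_fun setT f.
Proof. exact: measurable_int (Radon_Nikodym_integrable cdom). Qed.

Let B := [set x | (expR c)%:E < f x].

Let mB : measurable B.
Proof.
by rewrite -[B]setTI; apply: emeasurable_fun_o_infty.
Qed.

(* On [B] the density exceeds [expR c], while its integral is at most
   [expR c * nu B]. *)
Let muB0 : mu B = 0.
Proof.
have fB : \int[nu]_(x in B) f x = mu B by rewrite -Radon_Nikodym_integral.
have K0 : (0 < expR c)%R := expR_gt0 c.
have lower : (expR c)%:E * nu B <= mu B.
  rewrite -integral_cst// -fB; apply: ge0_le_integral => //.
  - by move=> x _; rewrite lee_fin ltW.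
  - exact: measurable_funTS.
  - by move=> x /ltW.
(* Finiteness comes from [expR c * nu B <= mu B <= 1]; it makes the constant integrable on [B], so
   that it can be subtracted from [f]. *)
have nuBfin : nu B \is a fin_num.
  rewrite ge0_fin_numE//; rewrite ltNge leye_eq; apply/negP => /eqP nuB.
  have := le_trans lower (probability_le1 mu mB).
  by rewrite nuB gt0_muley ?lte_fin// leye_eq.
have intf : nu.-integrable B f.
  exact: integrableS (Radon_Nikodym_integrable cdom).
have intc : nu.-integrable B (cst (expR c)%:E).
  apply/integrableP; split => //=.
  under eq_integral do rewrite ger0_norm ?expR_ge0//.
  by rewrite integral_cst//= ltey_eq fin_numM.
have int0 : \int[nu]_(x in B) (f x - (expR c)%:E) = 0.
  rewrite integralB// fB integral_cst//.
  apply/eqP; rewrite eq_le sube_ge0 ?fin_numM// lower andbT.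
  by rewrite leeBlDr ?fin_numM// add0e mu_le.
have : ae_eq nu B (fun x => f x - (expR c)%:E) (cst 0).
  apply/ae_eq_integral_abs => //.
    by apply: emeasurable_funB => //; exact: measurable_funTS.
  rewrite -int0; apply: eq_integral => x /[!inE] Bx.
  by rewrite gee0_abs// sube_ge0// ltW.
move=> [N [mN N0 BN]].
have BN' : B `<=` N.
  move=> x Bx; apply: BN => /= /(_ Bx) /= fx.
  by have := Bx; rewrite /B /= -sube_gt0 fx ltxx.
have nuB : nu B = 0 by exact: subset_measure0 N0.
by apply/eqP; rewrite eq_le measure_ge0 andbT (le_trans (mu_le mB))// nuB mule0.
Qed.

(** Outside the [mu]-null set [B] the density is at most [expR c], so the positive part of its
    logarithm is at most [c]. The negative part only lowers the integral, so it is dropped without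
    any integrability argument. *)
Lemma KL_le : KL mu nu <= c%:E.
Proof.
rewrite /KL asboolT//= -/f integralE.
have mlf : measurable_fun setT (fun x => lne (f x)).
  apply: measurable_lne_fin_num => // x; exact: Radon_Nikodym_fin_num.
apply: (@le_trans _ _ (\int[mu]_x (fun x => lne (f x))^\+ x)).
  by rewrite geeDl// oppe_le0; exact: integral_ge0.
apply: (@le_trans _ _ (\int[mu]_x c%:E)); last first.
  by rewrite integral_cst//= (probability_setT mu) mule1.
apply: ae_ge0_le_integral => //.
- exact: measurable_funepos.
- exists B; split => // x /= h; apply: contrapT => /negP.
  rewrite /B /= -leNgt => fx.
  apply: h => _; rewrite funeposE ge_max lee_fin c0 andbT.
  have [fx0|fx0] := leP (f x) 0; first by rewrite le0_lneNy ?leNye.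
  rewrite -(expRK c) -lne_EFin ?expR_gt0// lee_lne// in_itv/= leey andbT.
    exact: ltW.
  by rewrite lee_fin expR_ge0.
Qed.

End KL_bound.

Section standard_gaussian.
Variable R : realType.
Local Open Scope classical_set_scope.

Lemma qform1E n (x : n.-tuple R) :
  qform (invmx 1%:M) x = \sum_i tnth x i ^+ 2.
Proof.
rewrite /qform invmx1 mulmx1 mxE; apply: eq_bigr => i _.
by rewrite !mxE expr2.
Qed.

Lemma gauss_pdf1_consv n (p : R * n.-tuple R) :
  gauss_pdf 1%:M (consv p) = normal_pdf 0 1 p.1 * gauss_pdf 1%:M p.2.
Proof.
have pi2 : 0 <= pi *+ 2 :> R by rewrite mulrn_wge0// pi_ge0.
rewrite normal_pdfE ?oner_eq0// /normal_peak /normal_fun /gauss_pdf.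
rewrite !det1 !mulr1 expr1n mul1r subr0 mulrACA -invfM -sqrtrM//.
rewrite -expRD exprS mulr_natl !qform1E big_ord_recl /=; congr (_ * expR _).
rewrite [tnth _ ord0](_ : _ = p.1)//.
under eq_bigr do rewrite tnthS.
by rewrite mulrDl opprD mulNr.
Qed.

Lemma gauss1_setT n : gauss 1%:M [set: n.-tuple R] = 1%E.
Proof.
elim: n => [|n IHn].
  rewrite /gauss [LHS]integral_dirac//; last first.
    by apply/measurable_EFinP; exact: measurable_gauss_pdf.
  rewrite diracT mul1e /gauss_pdf qform1E big_ord0 mul0r oppr0 expR0.
  by rewrite det1 expr0 mul1r sqrtr1 invr1 mulr1.
have mg m : measurable_fun setT (fun x : m.-tuple R => (gauss_pdf 1%:M x)%:E).
  by apply/measurable_EFinP; exact: measurable_gauss_pdf.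
rewrite /gauss integral_lebnS//; last first.
  by move=> x; rewrite lee_fin gauss_pdf_ge0.
rewrite fubini_tonelli1//=; last 2 first.
- by apply: (measurableT_comp (mg n.+1)); exact: measurable_consv.
- by move=> x; rewrite lee_fin gauss_pdf_ge0.
rewrite -[RHS](integral_normal_pdf 0 1); apply: eq_integral => t _.
rewrite /fubini_F; under eq_integral do rewrite gauss_pdf1_consv EFinM /=.
rewrite ge0_integralZl_EFin ?normal_pdf_ge0//; last 2 first.
- by move=> x _; rewrite lee_fin gauss_pdf_ge0.
- exact: mg.
by rewrite -/(gauss 1%:M setT) IHn mule1.
Qed.

(** A separate name, so that the probability structure is attached to the identity covariance
    only. *)
Definition std_gauss n : set (n.-tuple R) -> \bar R := gauss 1%:M.
HB.instance Definition _ n := Measure.on (@std_gauss n).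
HB.instance Definition _ n :=
  Measure_isProbability.Build _ _ _ (@std_gauss n) (gauss1_setT n).

(* The ratio of the density of [P z], [z] standard Gaussian, to that of
   N(0, L^-1) is at most [(|det P| sqrt(det L))^-1] when [P^T L P <= 1]. *)
Lemma std_gauss_preimage_le n (L P : 'M[R]_n) (K : R) (A : set (n.-tuple R)) :
  (forall v : 'cV_n, ((P *m v)^T *m L *m (P *m v)) 0 0 <= (v^T *m v) 0 0) ->
  0 < \det L -> \det P != 0 -> 1 <= K * (`|\det P| * Num.sqrt (\det L)) ->
  measurable A ->
  (std_gauss (matvec P @^-1` A) <= K%:E * gauss (invmx L) A)%E.
Proof.
move=> PLP L0 P0 K1 mA.
have mPA : measurable (matvec P @^-1` A).
  by rewrite -[X in measurable X]setTI; exact: measurable_matvec.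
have mg S : measurable_fun setT (fun x : n.-tuple R => (gauss_pdf S x)%:E).
  by apply/measurable_EFinP; exact: measurable_gauss_pdf.
have K0 : 0 <= K.
  rewrite leNgt; apply/negP => K0; have : K * (`|\det P| * Num.sqrt (\det L)) <= 0.
    by apply: mulr_le0_ge0; [exact: ltW|exact: mulr_ge0].
  by move/(le_trans K1); rewrite ler10.
rewrite /std_gauss /gauss integral_mkcond [X in (_ <= _ * X)%E]integral_mkcond.
have mr S B : measurable B ->
    measurable_fun setT ((fun x : n.-tuple R => (gauss_pdf S x)%:E) \_ B).
  by move=> mB; apply/(measurable_restrictT _ _).1 => //; exact: measurable_funTS.
have r0 S B x : (0 <= ((fun x : n.-tuple R => (gauss_pdf S x)%:E) \_ B) x)%E.
  by apply: erestrict_ge0 => y _; rewrite lee_fin gauss_pdf_ge0.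
rewrite -[X in (_ <= _ * X)%E](ge0_integral_linear P0)//; last exact: mr.
have mrP : measurable_fun setT (fun x =>
    ((fun x : n.-tuple R => (gauss_pdf (invmx L) x)%:E) \_ A) (matvec P x)).
  by apply: measurableT_comp; [exact: mr|exact: measurable_matvec].
rewrite muleA -EFinM -ge0_integralZl_EFin ?mulr_ge0//.
apply: ge0_le_integral => //.
- exact: mr.
- exact: measurable_funeM.
move=> x _; rewrite !patchE.
have -> : (x \in matvec P @^-1` A) = (matvec P x \in A).
  by apply/idP/idP; rewrite !inE.
case: ifP => _; last by rewrite mule0.
rewrite -EFinM lee_fin /gauss_pdf invmxK det_inv det1 mulr1 mulrA.
have pi0 : 0 < (2 * pi) ^+ n :> R by rewrite exprn_gt0// mulr_gt0// pi_gt0.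
have -> : (Num.sqrt ((2 * pi) ^+ n * (\det L)^-1))^-1 =
    (Num.sqrt ((2 * pi) ^+ n))^-1 * Num.sqrt (\det L).
  by rewrite sqrtrM ?ltW// sqrtrV ?ltW// invfM invrK.
apply: ler_pM; rewrite ?expR_ge0 ?invr_ge0 ?sqrtr_ge0//.
  rewrite mulrCA -mulrA -[leLHS]mulr1 ler_wpM2l ?invr_ge0 ?sqrtr_ge0//.
rewrite ler_expR lerN2 ler_pM2r ?invr_gt0//.
by rewrite /qform invmx1 mulmx1 colv_matvec; exact: PLP.
Qed.

End standard_gaussian.

(** * The two algorithms *)

Section algorithms.
Variables (R : realType) (n : nat) (p : {poly R}).
Local Notation V := (n.+1.-tuple R).
Local Open Scope classical_set_scope.

Lemma colv_iter_matvec (L : 'M[R]_n.+1) i (w : V) :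
  colv (iter i (matvec L) w) = L ^+ i *m colv w.
Proof.
elim: i => [|i IHi]; first by rewrite expr0 mul1mx.
by rewrite iterS colv_matvec IHi exprS mulmxA.
Qed.

Lemma horner_mx_coef (L : 'M[R]_n.+1) :
  horner_mx L p = \sum_(i < size p) p`_i *: L ^+ i.
Proof.
rewrite -{1}[p]coefK poly_def rmorph_sum; apply: eq_bigr => i _.
by rewrite /= horner_mxZ rmorphXn/= horner_mx_X.
Qed.

(** The seed is the Gaussian vector [z] itself. As the default of [head] it is the first query; each
    later query is the latest response. *)
Let krylov_query k (s : V * k.-tuple V) : V := head s.1 s.2.

(** The latest response comes first, so index [size p - i] holds [L^i z]. For [i = 0] the index is
    out of range and the default of [nth] supplies [z]. *)
Let krylov_output (s : V * (size p).-tuple V) : V :=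
  cotuple (\sum_(i < size p) p`_i *: colv (nth s.1 s.2 (size p - i))).

Let measurable_nth k m :
  measurable_fun setT (fun s : V * k.-tuple V => nth s.1 s.2 m).
Proof.
have [mk|km] := ltnP m k.
  rewrite (_ : (fun s => _) =
      (fun s : V * k.-tuple V => tnth s.2 (Ordinal mk))).
    by apply: (measurableT_comp (measurable_tnth _)).
  by apply/funext => s; rewrite (tnth_nth s.1).
rewrite (_ : (fun s => _) = fst); first exact: measurable_fst.
by apply/funext => s; rewrite nth_default// size_tuple.
Qed.

Let measurable_krylov_query k : measurable_fun setT (@krylov_query k).
Proof.
rewrite (_ : @krylov_query k = (fun s => nth s.1 s.2 0)).
  exact: measurable_nth.
by apply/funext => s; rewrite nth0.
Qed.

Let measurable_krylov_output : measurable_fun setT krylov_output.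
Proof.
apply: measurable_cotuple => j; under eq_fun do rewrite summxE.
apply: measurable_sum => i; under eq_fun do rewrite !mxE.
apply: measurable_funM => //.
by apply: (measurableT_comp (measurable_tnth _)); exact: measurable_nth.
Qed.

Definition krylov_algorithm : algorithm R n.+1 (size p) :=
  Algorithm (@std_gauss R n.+1) measurable_krylov_query measurable_krylov_output.

Lemma nth_krylov_responses (L : 'M[R]_n.+1) k (w : V) m :
  nth w (@responses R n.+1 (size p) krylov_algorithm L k w) m =
  iter (k - m) (matvec L) w.
Proof.
elim: k m => [|k IHk] m; first by rewrite /= nth_nil.
case: m => [|m] /=.
  by rewrite /krylov_query /= -nth0 IHk subn0.
by rewrite IHk subSS.
Qed.

Lemma run_krylov (L : 'M[R]_n.+1) :
  run (A := krylov_algorithm) L = matvec (horner_mx L p).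
Proof.
apply/funext => w; rewrite /run /= /krylov_output matvec_cotuple; congr cotuple.
rewrite horner_mx_coef mulmx_suml; apply: eq_bigr => i _.
rewrite nth_krylov_responses subKn ?(ltnW (ltn_ord i))//.
by rewrite colv_iter_matvec scalemxAl.
Qed.

Let basis_query k (s : V * k.-tuple V) : V := cotuple (delta_mx (inord k) 0).

(** The response to the basis vector [e_j] is column [j] of the unknown matrix, stored at
    [rev_ord j] because the latest response comes first. *)
Let learned (s : V * n.+1.-tuple V) : 'M[R]_n.+1 :=
  \matrix_(i, j) tnth (tnth s.2 (rev_ord j)) i.

Let basis_output (s : V * n.+1.-tuple V) : V :=
  matvec (horner_mx (learned s) p) s.1.

Let measurable_learned i j : measurable_fun setT (fun s => learned s i j).
Proof.
under eq_fun do rewrite mxE; apply: (measurableT_comp (measurable_tnth _)).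
by apply: (measurableT_comp (measurable_tnth _)).
Qed.

Let measurable_horner_learned (q : {poly R}) i j :
  measurable_fun setT (fun s => horner_mx (learned s) q i j).
Proof.
elim/poly_ind: q i j => [|q c IHq] i j.
  by under eq_fun do rewrite rmorph0 mxE; exact: measurable_cst.
under eq_fun do rewrite rmorphD rmorphM/= horner_mx_X horner_mx_C !mxE.
apply: measurable_funD => //; apply: measurable_sum => k.
exact: measurable_funM.
Qed.

Let measurable_basis_output : measurable_fun setT basis_output.
Proof.
apply/measurable_fun_tnthP => i.
rewrite (_ : _ \o _ = fun s => \sum_j horner_mx (learned s) p i j * tnth s.1 j).
  apply: measurable_sum => j; apply: measurable_funM => //.
  by apply: (measurableT_comp (measurable_tnth _)).
by apply/funext => s; rewrite /= matvecE.
Qed.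

Let measurable_basis_query k : measurable_fun setT (@basis_query k).
Proof. exact: measurable_cst. Qed.

Definition basis_algorithm : algorithm R n.+1 n.+1 :=
  Algorithm (@std_gauss R n.+1) measurable_basis_query measurable_basis_output.

Lemma nth_basis_responses (L : 'M[R]_n.+1) k (w : V) m : (m < k)%N ->
  nth w (@responses R n.+1 n.+1 basis_algorithm L k w) m =
  matvec L (cotuple (delta_mx (inord (k - m.+1)) 0)).
Proof.
elim: k m => [//|k IHk] [_|m mk] /=; first by rewrite subn1.
by rewrite IHk ?subSS.
Qed.

Lemma run_basis (L : 'M[R]_n.+1) :
  run (A := basis_algorithm) L = matvec (horner_mx L p).
Proof.
apply/funext => w; rewrite /run /= /basis_output; congr (matvec (horner_mx _ p) w).
apply/matrixP => i j; rewrite mxE (tnth_nth w) nth_basis_responses//.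
rewrite tnth_mktuple cotupleK -colE mxE; congr (L i _); apply/val_inj.
by rewrite /= subnS subKn ?ltn_ord //= inordK.
Qed.

End algorithms.

(** * The divergence bound for a polynomial of the matrix, and the choice of its degree *)

Lemma bernoulli_inequality (R : realDomainType) (x : R) m :
  0 <= x <= 1 -> 1 - m%:R * x <= (1 - x) ^+ m.
Proof.
move=> /andP[x0 x1]; elim: m => [|m IHm]; first by rewrite mul0r subr0.
rewrite exprS; apply: (@le_trans _ _ ((1 - x) * (1 - m%:R * x))).
  rewrite -natr1 -subr_ge0.
  have -> : (1 - x) * (1 - m%:R * x) - (1 - (m%:R + 1) * x) = m%:R * x ^+ 2.
    by ring.
  by rewrite mulr_ge0 ?sqr_ge0.
by rewrite ler_wpM2l ?subr_ge0.
Qed.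

(** With [P = p(L)], the eigenvalues of [L P^2] lie in [[1 - delta, 1]]. The upper end gives
    [P L P <= 1]; the lower end and Bernoulli give [det L * (det P)^2 >= 1 - c]. The density ratio
    is then at most [expR c]. *)
Lemma KL_matrix_polynomial_le (R : realType) n (L : 'M[R]_n.+1) (p : {poly R})
    (kappa delta c : R) (mu : probability (n.+1.-tuple R) R) :
  L^T = L -> (forall a, eigenvalue L a -> 1 <= a <= kappa) ->
  (forall x, 1 <= x <= kappa -> 1 - delta <= x * p.[x] ^+ 2 <= 1) ->
  0 <= delta -> n.+1%:R * delta <= c -> c <= 1 / 2 ->
  (forall B, measurable B ->
    mu B = std_gauss (matvec (horner_mx L p) @^-1` B)%classic) ->
  (KL mu (gauss (invmx L)) <= c%:E)%E.
Proof.
move=> symL eigL plo delta0 deltac c12 muE; set P := horner_mx L p.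
have c0 : 0 <= c by rewrite (le_trans _ deltac)// mulr_ge0.
have delta1 : delta <= 1.
  have : delta <= n.+1%:R * delta by rewrite ler_peMl// ler1n.
  by lra.
pose g := 'X * p ^+ 2.
have gE : horner_mx L g = L *m P *m P.
  by rewrite rmorphM/= horner_mx_X rmorphXn/= expr2 mulrA.
have gv i : g.[spectral_value L i] =
    spectral_value L i * p.[spectral_value L i] ^+ 2 by rewrite !hornerE.
have sv i := eigL _ (eigenvalue_spectral_value symL i).
have detL0 : 0 < \det L.
  rewrite -[L]horner_mx_X det_horner_mx//; apply: prodr_gt0 => i _.
  by rewrite hornerX; have /andP[+ _] := sv i; exact: lt_le_trans.
have detg : 1 - c <= \det L * \det P ^+ 2.
  rewrite expr2 mulrA -!det_mulmx -gE det_horner_mx//.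
  apply: (@le_trans _ _ ((1 - delta) ^+ n.+1)).
    apply: (le_trans _ (bernoulli_inequality _ _)); last by rewrite delta0.
    by rewrite lerD2l lerN2.
  rewrite -[X in _ ^+ X](card_ord n.+1) -prodr_const; apply: ler_prod => i _.
  by rewrite subr_ge0 delta1 gv; have /andP[] := plo _ (sv i).
have detP0 : \det P != 0.
  by apply/eqP => P0; move: detg; rewrite P0 expr0n mulr0; lra.
apply: KL_le => // B mB; rewrite muE//; apply: std_gauss_preimage_le => //.
  have PL : P *m L = L *m P by exact: (comm_horner_mx p (erefl (L *m L))).
  move=> v; have -> : (P *m v)^T *m L *m (P *m v) = v^T *m horner_mx L g *m v.
    by rewrite gE -PL trmx_mul trmx_horner_mx// !mulmxA.
  apply: horner_mx_form_le => // i; rewrite gv.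
  by have /andP[] := plo _ (sv i).
have z0 : 0 <= expR c * (`|\det P| * Num.sqrt (\det L)).
  by rewrite mulr_ge0 ?expR_ge0 ?mulr_ge0 ?sqrtr_ge0.
rewrite -(expr_ge1 (n := 2) _ z0)//.
rewrite !exprMn real_normK ?num_real// (sqr_sqrtr (ltW detL0)).
rewrite (mulrC (\det P ^+ 2)) [expR c ^+ 2]expr2 -expRD.
(* After squaring, [expR (2 c) >= 1 + 2 c] remains to be played against [1 - c], and
   [(1 + 2 c) (1 - c) >= 1] holds for [0 <= c <= 1 / 2]. *)
apply: (@le_trans _ _ ((1 + (c + c)) * (1 - c))); first by nra.
apply: ler_pM => //; [lra|lra|exact: expR_ge1Dx].
Qed.

Theorem theorem52 (R : realType) :
  exists C : R, 0 < C /\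
    forall (d : nat) (kappa eps : R),
      (1 <= d)%N -> 1 <= kappa -> 0 < eps -> eps < 1 / 2 ->
      exists (n : nat) (A : algorithm R d n),
        n%:R <= C * Num.min (Num.sqrt kappa * ln (d%:R / eps)) d%:R /\
        forall L : 'M[R]_d,
          posdef L ->
          (forall a : R, eigenvalue L a -> 1 <= a <= kappa) ->
          (KL (output_law A L) (gauss (invmx L)) <= (eps ^+ 2)%:E)%E.
Proof.
have [rho [rho0 rho1 rhoE]] : exists rho : R,
    [/\ 0 < rho, rho < 1 & rho = 725 / 729].
  by exists (725 / 729); split; lra.
pose a := - ln rho.
have a0 : 0 < a by rewrite oppr_gt0 ln_lt0// rho0.
(* Chosen so that [2 k + 1 <= C l]: the degree parameter satisfies [k <= 2 l / a], and
   [1 <= 2 l]. *)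
pose C := 4 / a + 2.
have C1 : 1 <= C by rewrite /C; have : 0 < 4 / a by [exact: divr_gt0]; lra.
exists C; split; first exact: lt_le_trans C1.
case=> [//|n] kappa eps _ kappa1 eps0 eps12.
pose l := ln (n.+1%:R / eps).
have d0 : 0 < n.+1%:R :> R by rewrite ltr0n.
(* Since [d / eps >= 2], this follows from [ln 2 >= 1 / 2]; it absorbs the additive 1 of [2 k + 1]
   into a multiple of [l]. *)
have l12 : 1 / 2 <= l.
  have ln2 : 1 / 2 <= ln 2 :> R.
    have := @le_ln1Dx R (- (1 / 2)) _.
    rewrite (_ : 1 + - (1 / 2) = 2^-1); last by field.
    by rewrite lnV ?posrE// => h; have := h ltac:(lra); lra.
  apply: (le_trans ln2); rewrite ler_ln ?posrE// ?divr_gt0//.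
  rewrite ler_pdivlMr//; have : 1 <= n.+1%:R :> R by rewrite ler1n.
  by lra.
have l0 : 0 < l by lra.
(* With this [k], [rho^(k+1) <= exp(- 2 l) = (eps / d)^2], hence
   [d * rho^(k+1) <= eps^2 / d <= eps^2]. *)
pose k := Num.truncn (2 * l / a).
have kl : k%:R <= 2 * l / a.
  by rewrite truncn_le// divr_ge0 ?mulr_ge0 ?(ltW a0) ?(ltW l0).
have kg : 2 * l / a < k.+1%:R by exact: truncnS_gt.
have delta_le : n.+1%:R * rho ^+ k.+1 <= eps ^+ 2.
  have -> : rho ^+ k.+1 = expR (- (k.+1%:R * a)).
    by rewrite mulrN opprK expRM_natl lnK ?posrE.
  have h : expR (- (k.+1%:R * a)) <= (eps / n.+1%:R) ^+ 2.
    have -> : (eps / n.+1%:R) ^+ 2 = expR (- (2 * l)).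
      rewrite -mulrN expRM_natl -lnV ?posrE ?divr_gt0// invf_div lnK//.
      by rewrite posrE divr_gt0.
    by rewrite ler_expR lerN2 -ler_pdivrMr// ltW.
  apply: (@le_trans _ _ (n.+1%:R * (eps / n.+1%:R) ^+ 2)).
    by rewrite ler_pM2l.
  rewrite exprMn mulrCA -[leRHS]mulr1 ler_pM2l ?exprn_gt0//.
  rewrite expr2 mulrA mulfV ?gt_eqF// mul1r invf_le1//.
  by rewrite ler1n.
have eps2 : eps ^+ 2 <= 1 / 2 by nra.
have [p [sp plo]] := inverse_sqrt_approximation k kappa1.
rewrite -rhoE in plo.
have bound N (A : algorithm R n.+1 N) (L : 'M[R]_n.+1) :
    (forall B, measurable B ->
      output_law A L B = std_gauss (matvec (horner_mx L p) @^-1` B)%classic) ->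
    posdef L -> (forall a : R, eigenvalue L a -> 1 <= a <= kappa) ->
    (KL (output_law A L) (gauss (invmx L)) <= (eps ^+ 2)%:E)%E.
  move=> AE [symL _] eigL.
  apply: (KL_matrix_polynomial_le symL eigL plo _ delta_le eps2 AE).
  by rewrite exprn_ge0// ltW.
(* The term attaining the minimum selects the algorithm; both outputs equal [p(L) z], so [bound]
   serves both cases. *)
have [h|h] := leP (Num.sqrt kappa * l) n.+1%:R; last first.
  exists n.+1, (basis_algorithm n p); split; first by rewrite ler_peMl.
  by move=> L; apply: bound => B mB; rewrite -run_basis.
exists (size p), (krylov_algorithm n p); split; last first.
  by move=> L; apply: bound => B mB; rewrite -run_krylov.
apply: (le_trans sp); rewrite [leRHS]mulrCA mulrC ler_wpM2l ?sqrtr_ge0//.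
have -> : C * l = 2 * (2 * l / a) + 2 * l by rewrite /C; field; rewrite gt_eqF.
by rewrite natrD natrM lerD ?ler_pM2l// mulrC -ler_pdivrMr.
Qed.
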